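(* Let $r\in(0,1)$ and let $G$ be a simple graph with $n$ vertices, $m\ge 1$ edges, maximum degree $\Delta$, Zagreb index $Z=\sum_{i=1}^n d_i^2$ (where $d_i$ are the vertex degrees), and $Q$ cycles of length $4$. Then $$E(G)\le \frac{-1}{2r(r+1)^2}\cdot\frac{2Z-2m+8Q}{\Delta^3}+\frac{3r^2+2r+1}{2r(r+1)^2}\cdot\frac{2m}{\Delta}+n\Delta\,\frac{r^2(2r+1)}{2r(r+1)^2}.$$
   Context: The energy of a graph is $E(G)=\sum_{i=1}^n|\lambda_i|$, where $\lambda_1,\dots,\lambda_n$ are the eigenvalues of its adjacency matrix. *)

(* Defs.v *)
From mathcomp Require Import all_boot all_order all_algebra complex reals.

Set Implicit Arguments.
Unset Strict Implicit.
Unset Printing Implicit Defensive.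

Import Order.TTheory GRing.Theory Num.Theory.
Local Open Scope ring_scope.

(* The roots of the characteristic polynomial, with multiplicity (see
   char_poly_eigenvalues); there are exactly n of them (size_eigenvalues). *)
Definition eigenvalues (C : closedFieldType) (n : nat) (A : 'M[C]_n) : seq C :=
  sval (closed_field_poly_normal (char_poly A)).

Lemma char_poly_eigenvalues (C : closedFieldType) (n : nat) (A : 'M[C]_n) :
  char_poly A = \prod_(z <- eigenvalues A) ('X - z%:P).
Proof.
rewrite /eigenvalues; case: closed_field_poly_normal => s /= {1}->.
by rewrite (monicP (char_poly_monic A)) scale1r.
Qed.

Lemma size_eigenvalues (C : closedFieldType) (n : nat) (A : 'M[C]_n) :
  size (eigenvalues A) = n.
Proof.
by have := size_char_poly A; rewrite char_poly_eigenvalues size_prod_XsubC => -[].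
Qed.

(* A simple graph on the vertex set T is a symmetric irreflexive relation e. *)

Definition degree (T : finType) (e : rel T) (x : T) : nat := #|[set y | e x y]|.

Definition max_degree (T : finType) (e : rel T) : nat := \max_(x : T) degree e x.

Definition zagreb (T : finType) (e : rel T) : nat :=
  (\sum_(x : T) degree e x ^ 2)%N.

Definition edges (T : finType) (e : rel T) : {set {set T}} :=
  [set [set p.1; p.2] | p : T * T & e p.1 p.2].

Definition cycle_edges (T : finType) (s : seq T) : {set {set T}} :=
  [set [set x; next s x] | x in s].

(* Cycles are subgraphs, hence identified with their edge sets: the 2k closed
   traversals of a k-cycle (k >= 3) give one and the same element. *)
Definition cycles (T : finType) (e : rel T) (k : nat) : {set {set {set T}}} :=
  [set cycle_edges t | t : k.-tuple T & ucycleb e t].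

Definition adjacency (R : nzRingType) (T : finType) (e : rel T) : 'M[R]_#|T| :=
  \matrix_(i, j) (e (enum_val i) (enum_val j))%:R.

(* `|z| is the modulus of z, which has type R[i] with zero imaginary part. *)
Definition energy (R : rcfType) (T : finType) (e : rel T) : R :=
  \sum_(z <- eigenvalues (adjacency R[i] e)) complex.Re `|z|.

(* Main.v *)
Require Import Defs.
From mathcomp Require Import all_boot all_order all_algebra complex reals.
From mathcomp Require Import spectral sesquilinear ring lra.

Import Order.TTheory GRing.Theory Num.Theory.
Local Open Scope ring_scope.

(* The eigenvalues z are real and |z| <= Delta, so summing the
   inequality (x - r Delta)^2 (x - Delta) (x + (2r+1) Delta) <= 0, whose cubic
   term vanishes, over x = |z|, bounds the energy by the second and fourth
   spectral moments.  These count closed walks: tr A^2 = 2m, and a closed walk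
   a b c d has a = c (Z of them), or b = d (Z, of which 2m have both), or is one
   of the 8 traversals of a 4-cycle, so tr A^4 = 2Z - 2m + 8Q. *)

(** * Eigenvalues and power traces of Hermitian matrices *)

Lemma char_poly_similar (F : fieldType) (n : nat) (P A : 'M[F]_n) :
  P \in unitmx -> char_poly (invmx P *m A *m P) = char_poly A.
Proof.
move=> Pu; rewrite /char_poly.
have -> : char_poly_mx (invmx P *m A *m P) =
    map_mx polyC (invmx P) *m char_poly_mx A *m map_mx polyC P.
  rewrite /char_poly_mx !map_mxM mulmxBr mulmxBl; congr (_ - _).
  by rewrite scalar_mxC -mulmxA -map_mxM mulVmx // map_mx1 mulmx1.
by rewrite !det_mulmx mulrAC -det_mulmx -map_mxM mulVmx // map_mx1 det1 mul1r.
Qed.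

Section Hermitian.
Variables (C : numClosedFieldType) (n : nat) (A : 'M[C]_n).
Hypothesis A_herm : A \is hermsymmx.

Let A_diag : A = invmx (spectralmx A) *m diag_mx (spectral_diag A) *m spectralmx A.
Proof. exact/orthomx_spectralP/hermitian_normalmx. Qed.

(** Unitary diagonalisation makes [A] similar to a diagonal matrix, and unique factorisation of the
    common characteristic polynomial matches the roots up to order. *)
Lemma eigenvalues_hermitian :
  perm_eq (eigenvalues A) [seq spectral_diag A 0 i | i <- enum 'I_n].
Proof.
apply: prod_XsubC_eq; rewrite -char_poly_eigenvalues {1}A_diag.
rewrite char_poly_similar ?spectral_unit // char_poly_trig ?diag_mx_is_trig //.
rewrite big_map big_enum; apply: eq_bigr => i _.
by rewrite mxE eqxx.
Qed.

Lemma eigenvalues_hermitian_real z : z \in eigenvalues A -> z \is Num.real.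
Proof.
rewrite (perm_mem eigenvalues_hermitian) => /mapP[i _ ->].
by have /mxOverP := hermitian_spectral_diag_real A_herm; apply.
Qed.

(** One basis diagonalises every power of [A]; cyclicity of the trace then removes the change of
    basis. *)
Lemma mxtrace_exp_hermitian k : \tr (A ^+ k) = \sum_(z <- eigenvalues A) z ^+ k.
Proof.
have -> : A ^+ k = invmx (spectralmx A)
    *m diag_mx (\row_i spectral_diag A 0 i ^+ k) *m spectralmx A.
  elim: k => [|k IHk].
    have -> : diag_mx (\row_i spectral_diag A 0 i ^+ 0) = 1%:M.
      by apply/matrixP => i j; rewrite !mxE expr0.
    by rewrite mulmx1 mulVmx ?spectral_unit.
  rewrite exprSr IHk -[LHS]/(_ *m A) [X in _ *m X = _]A_diag !mulmxA.
  rewrite mulmxK ?spectral_unit // -[X in X *m _]mulmxA mulmx_diag.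
  congr (_ *m diag_mx _ *m _); apply/rowP => i; rewrite !mxE.
  by rewrite exprSr.
rewrite mxtrace_mulC mulmxA mulmxV ?spectral_unit // mul1mx mxtrace_diag.
rewrite (perm_big _ eigenvalues_hermitian) big_map big_enum /=.
by apply: eq_bigr => i _; rewrite mxE.
Qed.

End Hermitian.

(* Compare the l^1 norms of both sides of v *m A = z *: v. *)
Lemma norm_eigenvalue_le (C : numClosedFieldType) (n : nat) (A : 'M[C]_n) (D z : C) :
  (forall i, \sum_j `|A i j| <= D) -> z \in eigenvalues A -> `|z| <= D.
Proof.
move=> A_le; rewrite -root_prod_XsubC -char_poly_eigenvalues.
rewrite -eigenvalue_root_char => /eigenvalueP[v vA v_neq0].
have v_gt0 : 0 < \sum_i `|v 0 i|.
  have /rV0Pn[i vi] := v_neq0.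
  by rewrite (bigD1 i) //= ltr_pwDl ?normr_gt0 ?sumr_ge0.
rewrite -(ler_pM2r v_gt0) mulr_sumr.
under eq_bigr => j _.
  rewrite -normrM (_ : z * v 0 j = \sum_i v 0 i * A i j); last first.
    by have /rowP/(_ j) := vA; rewrite !mxE.
  over.
apply: (@le_trans _ _ (\sum_j \sum_i `|v 0 i| * `|A i j|)).
  apply: ler_sum => j _; apply: le_trans (ler_norm_sum _ _ _) _.
  by apply: ler_sum => i _; rewrite normrM.
rewrite exchange_big /= mulr_sumr; apply: ler_sum => i _.
by rewrite -mulr_sumr mulrC ler_wpM2r.
Qed.

(** * The scalar inequality *)

Lemma quartic_bound (R : realFieldType) (r x D : R) :
  0 < r -> 0 < D -> 0 <= x <= D ->
  x <= (- 1) / (2 * r * (r + 1) ^+ 2) * (x ^+ 4 / D ^+ 3)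
    + (3 * r ^+ 2 + 2 * r + 1) / (2 * r * (r + 1) ^+ 2) * (x ^+ 2 / D)
    + D * (r ^+ 2 * (2 * r + 1) / (2 * r * (r + 1) ^+ 2)).
Proof.
move=> r_gt0 D_gt0 /andP[x_ge0 x_le].
rewrite -subr_ge0.
set c := _ - x.
(* The double root [r * D] does not affect the sign, [D] bounds the range of [x], and
   [- (2 * r + 1) * D] makes the four roots sum to zero, which removes the cubic term. The
   denominator normalises the coefficient of [x] to -1. *)
have -> : c = (x - r * D) ^+ 2 * ((D - x) * (x + (2 * r + 1) * D))
    / (2 * r * (r + 1) ^+ 2 * D ^+ 3).
  rewrite /c; field; rewrite !gt_eqF //=; lra.
apply: divr_ge0; last by rewrite !mulr_ge0 ?exprn_ge0 //; lra.
rewrite mulr_ge0 ?sqr_ge0 // mulr_ge0 ?subr_ge0 // addr_ge0 // mulr_ge0 //; lra.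
Qed.

(** * Counting edges, 4-cycles and closed walks *)

Lemma eq_set2 (T : finType) (a b c d : T) :
  ([set a; b] == [set c; d])
    = ((a == c) && (b == d)) || ((a == d) && (b == c)).
Proof.
apply/eqP/idP => [abcd|/orP[]/andP[/eqP-> /eqP->] //]; last exact: setUC.
have := set22 c d; have := set21 c d; rewrite -abcd !inE !(eq_sym c) !(eq_sym d).
have := set22 a b; have := set21 a b; rewrite abcd !inE.
by case: (a == c) (a == d) (b == c) (b == d) => [] [] [] [].
Qed.

Lemma degreeE (T : finType) (e : rel T) x : degree e x = (\sum_y e x y)%N.
Proof.
rewrite /degree cardsE -sum1_card big_mkcond; apply: eq_bigr => y _.
by rewrite unfold_in; case: (e x y).
Qed.

(** Double counting along the fibers of [h]. It serves with [k = 2] for oriented edges and with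
    [k = 8] for traversals of 4-cycles. *)
Lemma card_imset_fibers (I J : finType) (h : I -> J) (A : {pred I}) (k : nat) :
  (forall i, i \in A -> #|[pred j in A | h j == h i]| = k) ->
  #|A| = (k * #|[set h i | i in A]|)%N.
Proof.
move=> hk; rewrite -sum1_card (partition_big_imset h) /=.
rewrite (eq_bigr (fun=> k)) ?sum_nat_const 1?mulnC // => _ /imsetP[i Ai ->].
by rewrite sum1_card hk.
Qed.

(** The degrees count ordered adjacent pairs, and without loops each edge comes from exactly two of
    them, [(x, y)] and [(y, x)]. *)
Lemma handshake (T : finType) (e : rel T) :
  symmetric e -> irreflexive e -> (\sum_x degree e x = 2 * #|edges e|)%N.
Proof.
move=> e_sym e_irr; rewrite -(card_imset_fibers _ _ (fun p => [set p.1; p.2])) /=.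
  rewrite -sum1_card big_mkcond [RHS]big_mkcond /=.
  under eq_bigr do rewrite degreeE.
  rewrite pair_bigA; apply: eq_bigr => -[x y] _ /=.
  by rewrite inE; case: (e x y).
move=> [x y]; rewrite inE /= => exy.
have xy : x != y by apply: contraTneq exy => ->; rewrite e_irr.
transitivity #|[set (x, y); (y, x)]|.
  apply: eq_card => -[z w]; rewrite !inE /= eq_set2 !xpair_eqE.
  apply: andb_idl => /orP[]/andP[/eqP-> /eqP->] //; by rewrite e_sym.
by rewrite cards2 xpair_eqE negb_and xy.
Qed.

Lemma mem_cycle_edges4 (T : finType) (a b c d : T) (E : {set T}) :
  uniq [:: a; b; c; d] ->
  E \in cycle_edges [:: a; b; c; d]
    = [|| E == [set a; b], E == [set b; c], E == [set c; d] | E == [set d; a]].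
Proof.
rewrite /= !inE !negb_or -!andbA => /and5P[ab ac ad bc /and3P[bd cd _]].
have na : next [:: a; b; c; d] a = b by rewrite /= eqxx.
have nb : next [:: a; b; c; d] b = c by rewrite /= (eq_sym b) (negPf ab) eqxx.
have nc : next [:: a; b; c; d] c = d.
  by rewrite /= !(eq_sym c) (negPf ac) (negPf bc) eqxx.
have nd : next [:: a; b; c; d] d = a.
  by rewrite /= !(eq_sym d) (negPf ad) (negPf bd) (negPf cd) eqxx.
apply/imsetP/idP => [[x]|].
  by rewrite !inE => /or4P[]/eqP-> ->; rewrite ?(na, nb, nc, nd) eqxx ?orbT.
case/or4P => /eqP->; [exists a|exists b|exists c|exists d];
  by rewrite ?(na, nb, nc, nd) // !inE eqxx ?orbT.
Qed.

(** The dihedral orbit of [(a, b, c, d)]: its four rotations, then the four rotations of its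
    reversal. *)
Definition square_traversals (T : Type) (a b c d : T) : seq (4.-tuple T) :=
  [:: [tuple a; b; c; d]; [tuple b; c; d; a]; [tuple c; d; a; b]; [tuple d; a; b; c];
      [tuple a; d; c; b]; [tuple d; c; b; a]; [tuple c; b; a; d]; [tuple b; a; d; c]].

(** The edge set of a 4-cycle leaves free only the starting vertex and the direction. *)
Lemma eq_cycle_edges4 (T : finType) (a b c d : T) (t : 4.-tuple T) :
  uniq [:: a; b; c; d] -> uniq t ->
  (cycle_edges t == cycle_edges [:: a; b; c; d]) = (t \in square_traversals T a b c d).
Proof.
case/tupleP: t => x t; case/tupleP: t => y t; case/tupleP: t => z t.
case/tupleP: t => w t; rewrite (tuple0 t) /= => abcd xyzw.
have abcdN := abcd; rewrite /= !inE !negb_or -!andbA in abcdN.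
have [ab ac ad bc /and3P[bd cd _]] := and5P abcdN => {abcdN}.
have xyzwN := xyzw; rewrite /= !inE !negb_or -!andbA in xyzwN.
have [xy xz xw yz /and3P[yw zw _]] := and5P xyzwN => {xyzwN}.
have neqs := (negPf ab, negPf ac, negPf ad, negPf bc, negPf bd, negPf cd).
have neqs' := (eq_sym b a, eq_sym c a, eq_sym d a, eq_sym c b, eq_sym d b, eq_sym d c).
apply/eqP/idP => [eqE|]; last first.
(* Each of the eight traversals permutes the four edges, up to swapping the ends of an edge. *)
{ rewrite !inE => teq; apply/setP => E.
  rewrite !mem_cycle_edges4 //; move: teq.
  rewrite -![[tuple x; y; z; w] == _]val_eqE /= !eqseq_cons !andbT.
  do 7?[case/orP]; case/and4P => /eqP-> /eqP-> /eqP-> /eqP->.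
  all: rewrite ?(setUC [set b] [set a]) ?(setUC [set c] [set b]).
  all: rewrite ?(setUC [set d] [set c]) ?(setUC [set a] [set d]).
  all: by case: (E == [set a; b]) (E == [set b; c]) (E == [set c; d])
    (E == [set d; a]) => [] [] [] []. }
have Hm E : [|| E == [set x; y], E == [set y; z], E == [set z; w] | E == [set w; x]]
    = [|| E == [set a; b], E == [set b; c], E == [set c; d] | E == [set d; a]].
  by rewrite -!mem_cycle_edges4 // eqE.
have := Hm [set x; y]; have := Hm [set y; z]; have := Hm [set z; w].
rewrite !eqxx ?orbT !eq_set2 /= => /esym Hzw /esym Hyz /esym.
(* The pair [(x, y)] is one of the four edges in one of two directions. Then [z] is a neighbour of
   [y] on the square other than [x], and [w] a neighbour of [z] other than [y], so both are
   forced. *)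
case/or4P => /orP[]/andP[/eqP ? /eqP ?]; subst x y;
   move: Hyz; rewrite ?eqxx ?neqs ?neqs' ?neqs /= ?andbT ?andbF ?orbF /= ?andbF ?orbF.
  all: do ?[case/orP]; move/eqP => ?; subst z.
  all: move: xz xw yz yw zw Hzw; rewrite ?eqxx ?neqs ?neqs' ?neqs //= ?orbF ?andbF ?orbF.
all: move=> _ n1 _ n2 n3 /orP[]/eqP w_eq; move: n1 n2 n3.
all: rewrite w_eq ?eqxx // => _ _ _.
all: by rewrite !inE -!val_eqE /= !eqxx ?orbT.
Qed.

Lemma card_ucycles4 (T : finType) (e : rel T) : symmetric e ->
  #|[set t : 4.-tuple T | ucycleb e t]| = (8 * #|cycles e 4|)%N.
Proof.
move=> e_sym; apply: (card_imset_fibers _ _ (fun t : 4.-tuple T => cycle_edges t)).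
case/tupleP => a t; case/tupleP: t => b t; case/tupleP: t => c t.
case/tupleP: t => d t; rewrite (tuple0 t) inE => /andP[abcd_cycle abcd].
have := abcd; rewrite /= !inE !negb_or -!andbA => /and5P[ab ac ad bc /and3P[bd cd _]].
(* Symmetry of [e] allows reversing the direction, so the whole orbit consists of cycles of the
   graph and is the full fiber. *)
have ucycle_trav s : s \in square_traversals T a b c d -> ucycleb e s.
{ move: abcd_cycle abcd; rewrite /ucycleb /= !inE !negb_or !andbT.
  rewrite ?(e_sym b a, e_sym c b, e_sym d c, e_sym a d).
  rewrite ?(eq_sym b a, eq_sym c a, eq_sym d a, eq_sym c b, eq_sym d b, eq_sym d c).
  move=> /and4P[eab ebc ecd eda] neqs.
  do 7?[case/orP]; move=> /eqP-> /=; rewrite !inE !negb_or !andbT.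
  all: rewrite ?(e_sym b a, e_sym c b, e_sym d c, e_sym a d).
  all: rewrite ?(eq_sym b a, eq_sym c a, eq_sym d a, eq_sym c b, eq_sym d b, eq_sym d c).
  all: by rewrite eab ebc ecd eda ab ac ad bc bd cd. }
transitivity #|square_traversals T a b c d|.
  apply: eq_card => s; rewrite [LHS]inE /= inE; apply/andP/idP.
    by case=> /andP[_ s_uniq]; rewrite eq_cycle_edges4.
  move=> s_in; have s_cyc := ucycle_trav _ s_in.
  by have /andP[_ s_uniq] := s_cyc; rewrite eq_cycle_edges4.
(* The eight traversals are pairwise distinct because the four vertices are. *)
apply/eqP; rewrite (card_uniqP _) //=.
rewrite !inE -!val_eqE /= !eqseq_cons.
rewrite ?(eq_sym b a, eq_sym c a, eq_sym d a, eq_sym c b, eq_sym d b, eq_sym d c).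
by rewrite (negPf ab) (negPf ac) (negPf ad) (negPf bc) (negPf bd) (negPf cd) !andbF.
Qed.

Lemma big_tuple4 (T : finType) (F : 4.-tuple T -> nat) :
  (\sum_t F t = \sum_a \sum_b \sum_c \sum_d F [tuple a; b; c; d])%N.
Proof.
rewrite pair_bigA pair_bigA pair_bigA /=.
rewrite (reindex (fun p : T * T * T * T => [tuple p.1.1.1; p.1.1.2; p.1.2; p.2])) //=.
exists (fun t : 4.-tuple T => (tnth t 0, tnth t 1, tnth t 2, tnth t 3)).
  by move=> [[[a b] c] d] _.
case/tupleP => a t; case/tupleP: t => b t; case/tupleP: t => c t.
by case/tupleP: t => d t _; rewrite (tuple0 t); apply: val_inj.
Qed.

Definition closed_walks4 (T : finType) (e : rel T) : nat :=
  (\sum_a \sum_b \sum_c \sum_d [&& e a b, e b c, e c d & e d a])%N.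

(** Inclusion-exclusion on the coincidences [a = c] and [b = d]. The [2 * #|edges e|] walks having
    both are added on the left, which avoids truncated subtraction in [nat]. *)
Lemma closed_walks4_eq (T : finType) (e : rel T) :
  symmetric e -> irreflexive e ->
  (closed_walks4 T e + 2 * #|edges e| = 2 * zagreb e + 8 * #|cycles e 4|)%N.
Proof.
move=> e_sym e_irr.
pose W a b c d := [&& e a b, e b c, e c d & e d a].
(* With [c = a], the vertices [b] and [d] are independent neighbours of [a], giving the squared
   degree. *)
have zagreb_ac : zagreb e = (\sum_a \sum_b \sum_c \sum_d (W a b c d && (a == c)))%N.
  apply: eq_bigr => a _; rewrite degreeE -mulnn big_distrl /=.
  apply: eq_bigr => b _; rewrite [RHS](bigD1 a) //= [X in (_ + X)%N]big1 ?addn0.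
    rewrite big_distrr /=; apply: eq_bigr => d _.
    by rewrite /W eqxx (e_sym b) (e_sym d) andbT andbA andbb andbb mulnb.
  by move=> c /negPf ca; rewrite big1 // => d _; rewrite eq_sym ca andbF.
have zagreb_bd : zagreb e = (\sum_a \sum_b \sum_c \sum_d (W a b c d && (b == d)))%N.
  rewrite exchange_big; apply: eq_bigr => b _ /=; rewrite degreeE -mulnn big_distrl /=.
  apply: eq_bigr => a _; rewrite big_distrr; apply: eq_bigr => c _ /=.
  rewrite (bigD1 b) //= big1 ?addn0 => [|d /negPf db].
    by rewrite /W eqxx andbT (e_sym c) (e_sym a) mulnb; case: (e b a) (e b c) => [] [].
  by rewrite eq_sym db andbF.
have edges_both :
    (2 * #|edges e| = \sum_a \sum_b \sum_c \sum_d (W a b c d && (a == c) && (b == d)))%N.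
  rewrite -handshake //; apply: eq_bigr => a _; rewrite degreeE.
  apply: eq_bigr => b _; rewrite (bigD1 a) //= [X in (_ + X)%N]big1 ?addn0.
    rewrite (bigD1 b) //= big1 ?addn0 => [|d /negPf db].
      by rewrite /W !eqxx (e_sym b) !andbT !andbb.
    by rewrite (eq_sym b) db andbF.
  by move=> c /negPf ca; rewrite big1 // => d _; rewrite (eq_sym a) ca andbF.
rewrite [(2 * zagreb e)%N]mul2n -addnn {1}zagreb_ac zagreb_bd edges_both -card_ucycles4 //.
rewrite -sum1_card [X in (_ = _ + X)%N]big_mkcond big_tuple4 /= /closed_walks4.
rewrite -!big_split; apply: eq_bigr => a _; rewrite -!big_split; apply: eq_bigr => b _.
rewrite -!big_split; apply: eq_bigr => c _; rewrite -!big_split; apply: eq_bigr => d _ /=.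
rewrite -/(W _ _ _ _) inE.
(* Consecutive vertices differ since there are no loops, so only the two diagonals can fail to be
   distinct. *)
have -> : ucycleb e [tuple a; b; c; d] = [&& W a b c d, a != c & b != d].
  rewrite /ucycleb /= !inE !negb_or !andbT.
  apply: andb_id2l => /and4P[eab ebc ecd eda].
  have adj_neq x y : e x y -> x != y by apply: contraTneq => ->; rewrite e_irr.
  rewrite (eq_sym a d) (adj_neq a b) // (adj_neq b c) // (adj_neq c d) //.
  by rewrite (adj_neq d a) // !andbT.
by case: (W a b c d) (a == c) (b == d) => [] [] [].
Qed.

(** * The adjacency matrix and its traces *)

Lemma sum_enum_val (V : nmodType) (T : finType) (F : T -> V) :
  \sum_(i < #|T|) F (enum_val i) = \sum_x F x.
Proof. by rewrite [RHS](reindex (@enum_val _ T)) //=; exact/onW_bij/enum_val_bij. Qed.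

Section Adjacency.
Variables (T : finType) (e : rel T).

Lemma sum_adjacency_row (R : nzRingType) i :
  \sum_j adjacency R e i j = (degree e (enum_val i))%:R.
Proof.
rewrite degreeE natr_sum -[RHS]sum_enum_val.
by apply: eq_bigr => j _; rewrite mxE.
Qed.

Lemma mxtrace_adjacency_exp2 (R : nzRingType) : symmetric e -> irreflexive e ->
  \tr (adjacency R e ^+ 2) = (2 * #|edges e|)%:R.
Proof.
move=> e_sym e_irr; rewrite -handshake // natr_sum -[RHS]sum_enum_val.
apply: eq_bigr => i _; rewrite expr2 mxE -sum_adjacency_row.
by apply: eq_bigr => j _; rewrite !mxE (e_sym (enum_val j)) -natrM mulnb andbb.
Qed.

Lemma mxtrace_adjacency_exp4 (R : nzRingType) :
  \tr (adjacency R e ^+ 4) = (closed_walks4 T e)%:R.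
Proof.
rewrite natr_sum -[RHS]sum_enum_val; apply: eq_bigr => i _.
rewrite !exprS expr0 mulr1 mxE natr_sum -[RHS]sum_enum_val; apply: eq_bigr => j _.
rewrite [X in _ * X = _]mxE mulr_sumr natr_sum -[RHS]sum_enum_val; apply: eq_bigr => k _.
rewrite [X in _ * (_ * X) = _]mxE !mulr_sumr natr_sum -[RHS]sum_enum_val.
by apply: eq_bigr => l _; rewrite !mxE -!natrM !mulnb.
Qed.

End Adjacency.

Lemma adjacency_hermitian (C : numClosedFieldType) (T : finType) (e : rel T) :
  symmetric e -> adjacency C e \is hermsymmx.
Proof.
move=> e_sym; apply: realsym_hermsym.
  apply/is_hermitianmxP; rewrite expr0 scale1r; apply/matrixP => i j; rewrite !mxE /=.
  by rewrite e_sym.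
by apply/mxOverP => i j; rewrite mxE realn.
Qed.

Lemma degree_le_max_degree (T : finType) (e : rel T) x : (degree e x <= max_degree e)%N.
Proof. exact: leq_bigmax. Qed.

Lemma max_degree_gt0 (T : finType) (e : rel T) :
  (0 < #|edges e|)%N -> (0 < max_degree e)%N.
Proof.
case/card_gt0P => E /imsetP[[x y]]; rewrite inE /= => exy _.
apply: leq_trans (degree_le_max_degree T e x).
by apply/card_gt0P; exists y; rewrite inE.
Qed.

(** * Bounds and moments of the moduli of graph eigenvalues *)

Section Spectrum.
Variables (R : rcfType) (T : finType) (e : rel T).
Hypothesis e_sym : symmetric e.

Lemma real_complex_Re_norm (z : R[i]) : (complex.Re `|z|)%:C%C = `|z|.
Proof. by rewrite RRe_real // ger0_real. Qed.

(** The absolute row sums of the adjacency matrix are the degrees. *)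
Lemma eigenvalue_modulus_le z : z \in eigenvalues (adjacency R[i] e) ->
  0 <= complex.Re `|z| <= (max_degree e)%:R.
Proof.
move=> z_eig; rewrite -!lecR real_complex_Re_norm normr_ge0 /=.
rewrite rmorph_nat; apply: norm_eigenvalue_le z_eig => i.
rewrite (eq_bigr (adjacency R[i] e i)) => [|j _]; last by rewrite mxE normr_nat.
by rewrite sum_adjacency_row ler_nat degree_le_max_degree.
Qed.

(** Real eigenvalues satisfy [|z|^2 = z^2], so even moments of the moduli are traces. The identity
    lives in [R[i]] and returns to [R] by injectivity of the embedding. *)
Lemma sum_modulus_exp k :
  (\sum_(z <- eigenvalues (adjacency R[i] e)) complex.Re `|z| ^+ (2 * k))%:C%C
    = \tr (adjacency R[i] e ^+ (2 * k)).
Proof.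
rewrite mxtrace_exp_hermitian ?adjacency_hermitian //.
rewrite rmorph_sum; apply: eq_big_seq => z z_eig /=.
rewrite rmorphXn /= real_complex_Re_norm !exprM real_normK //.
by apply: eigenvalues_hermitian_real z_eig; apply: adjacency_hermitian.
Qed.

Lemma sum_modulus_exp2 : irreflexive e ->
  \sum_(z <- eigenvalues (adjacency R[i] e)) complex.Re `|z| ^+ 2 = (2 * #|edges e|)%:R.
Proof.
move=> e_irr; apply: (fmorph_inj (real_complex R)).
by rewrite rmorph_nat -mxtrace_adjacency_exp2 // -(sum_modulus_exp 1).
Qed.

Lemma sum_modulus_exp4 :
  \sum_(z <- eigenvalues (adjacency R[i] e)) complex.Re `|z| ^+ 4
    = (closed_walks4 T e)%:R.
Proof.
apply: (fmorph_inj (real_complex R)).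
by rewrite rmorph_nat -mxtrace_adjacency_exp4 -(sum_modulus_exp 2).
Qed.

End Spectrum.

Theorem theorem2p3 (R : realType) (r : R) (T : finType) (e : rel T)
    (hr0 : 0 < r) (hr1 : r < 1)
    (e_sym : symmetric e) (e_irr : irreflexive e)
    (he : (1 <= #|edges e|)%N) :
  let n : R := #|T|%:R in
  let m : R := #|edges e|%:R in
  let Delta : R := (max_degree e)%:R in
  let Z : R := (zagreb e)%:R in
  let Q : R := #|cycles e 4|%:R in
  is_true (energy R e <=
    (- 1) / (2 * r * (r + 1) ^+ 2) * ((2 * Z - 2 * m + 8 * Q) / Delta ^+ 3)
    + (3 * r ^+ 2 + 2 * r + 1) / (2 * r * (r + 1) ^+ 2) * (2 * m / Delta)
    + n * Delta * (r ^+ 2 * (2 * r + 1) / (2 * r * (r + 1) ^+ 2))).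
Proof.
move=> n m Delta Z Q.
have Delta_gt0 : 0 < Delta by rewrite ltr0n max_degree_gt0.
have S2 : \sum_(z <- eigenvalues (adjacency R[i] e)) complex.Re `|z| ^+ 2 = 2 * m.
  by rewrite sum_modulus_exp2 // natrM.
have S4 : \sum_(z <- eigenvalues (adjacency R[i] e)) complex.Re `|z| ^+ 4
    = 2 * Z - 2 * m + 8 * Q.
  rewrite sum_modulus_exp4 // /Z /m /Q addrAC -!natrM -natrD.
  by apply/eqP; rewrite eq_sym subr_eq -natrD closed_walks4_eq.
(* [big_seq] retains the membership of [z] among the eigenvalues, on which the bound by [Delta]
   depends. *)
rewrite /energy big_seq.
apply: le_trans.
  apply: ler_sum => z z_eig.
  exact: (quartic_bound R r _ Delta hr0 Delta_gt0
    (eigenvalue_modulus_le R T e z z_eig)).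
rewrite -big_seq !big_split /= -!mulr_sumr -!mulr_suml S2 S4.
(* The constant term is summed once per eigenvalue, hence the factor [n]. *)
rewrite big_const_seq count_predT size_eigenvalues iter_addr_0.
by rewrite -[X in _ <= _ + X]mulrA [X in _ <= _ + X]mulr_natl -!mulrnAr.
Qed.
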